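(* Let $N\ge 4$ be an integer, let $\beta_N$ be a constant and let $(\alpha_{N,n})_{n\in\mathbb{Z}}$ be a 2-periodic sequence of constants, $\alpha_{N,n+2}=\alpha_{N,n}$. Let $(t_n)_{n\in\mathbb{Z}}$ be a sequence of nonzero complex numbers satisfying $$t_nt_{n+N}=\alpha_{N,n}\,t_{n+1}t_{n+N-1}+\beta_N\,t_{n+2}t_{n+N-2}\qquad (n\in\mathbb{Z}).$$ Then the sequence $(y_n)$ defined by $$y_n=\frac{t_nt_{n+3}}{t_{n+1}t_{n+2}}$$ is a solution, for some constant $H_N$ (independent of $n$), of the equation $$y_{n+1}\left(\sum_{j=0}^{N-3}y_{n+j}-H_N\right)=y_{n+N-2}\left(\sum_{j=0}^{N-3}y_{n+j+2}-H_N\right)\qquad (n\in\mathbb{Z}).$$ *)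

(* Defs.v *)
From mathcomp Require Export all_boot all_order all_algebra.
From mathcomp Require Export reals.
From mathcomp.real_closed Require Export complex.

(* Main.v *)
(** Eliminating the 2-periodic coefficient between the recurrences at n and n+2
    gives y_(n+N-1) - y_n = beta (w_(n+1) - w_n), where
    w_n = t_(n+3) t_(n+N-2) / (t_(n+1) t_(n+N)). Hence, with S_n the sum of the
    N-1 terms y_n, ..., y_(n+N-2), the quantity S_n - beta w_n is a constant H.
    The equation to prove reduces to y_(n+1) (S_n - H) = y_(n+N-2) (S_(n+1) - H),
    that is to y_(n+1) w_n = y_(n+N-2) w_(n+1), which holds by definition of w. *)
Require Import Defs.
From mathcomp Require Import all_boot all_order all_algebra reals.
From mathcomp.real_closed Require Import complex.
From mathcomp Require Import ring.
Import Order.TTheory GRing.Theory Num.Theory.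
Local Open Scope ring_scope.
Local Open Scope complex_scope.

Lemma int_shift_invariant (T : Type) (f : int -> T) :
  (forall n : int, f (n + 1) = f n) -> forall n : int, f n = f 0.
Proof.
move=> fS; elim/int_ind=> [//|n <-|n <-].
  by rewrite -[RHS]fS; congr f; rewrite intS; ring.
by rewrite -[LHS]fS; congr f; rewrite intS; ring.
Qed.

Section SomosReduction.

Variables (F : fieldType) (t y : int -> F) (N : int).
Hypothesis t_neq0 : forall n, t n != 0.
Hypothesis yE : forall n, y n = (t n * t (n + 3)) / (t (n + 1) * t (n + 2)).

Definition twist (n : int) : F :=
  (t (n + 3) * t (n + N - 2)) / (t (n + 1) * t (n + N)).

(** After cancellation both products equal [t (n + 4) * t (n + N - 2) / (t (n + 2) * t (n + N))]. *)
Lemma mul_twist (n : int) :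
  y (n + 1) * twist n = y (n + N - 2) * twist (n + 1).
Proof.
rewrite !yE /twist.
(* [field] treats each [t _] as an atom, so equal indices must first be given the same form. *)
have -> : n + 1 + 3 = n + 4 by ring.
have -> : n + 1 + 1 = n + 2 by ring.
have -> : n + 1 + 2 = n + 3 by ring.
have -> : n + N - 2 + 3 = n + N + 1 by ring.
have -> : n + N - 2 + 1 = n + N - 1 by ring.
have -> : n + N - 2 + 2 = n + N by ring.
have -> : n + 1 + N - 2 = n + N - 1 by ring.
have -> : n + 1 + N = n + N + 1 by ring.
by field; rewrite !t_neq0.
Qed.

Lemma sub_twist (beta : F) (alpha : int -> F) :
  (forall n, alpha (n + 2) = alpha n) ->
  (forall n, t n * t (n + N) =
     alpha n * t (n + 1) * t (n + N - 1) + beta * t (n + 2) * t (n + N - 2)) ->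
  forall n, y (n + N - 1) - y n = beta * (twist (n + 1) - twist n).
Proof.
move=> alpha2 tE n.
(* As [t] never vanishes, the recurrence can be solved for [alpha]; periodicity then becomes an
   identity in [t] and [beta] alone. *)
have alphaE m : alpha m =
    (t m * t (m + N) - beta * t (m + 2) * t (m + N - 2))
      / (t (m + 1) * t (m + N - 1)).
  by rewrite tE; field; rewrite !t_neq0.
move: (alpha2 n); rewrite !alphaE !yE /twist.
have -> : n + 2 + N = n + N + 2 by ring.
have -> : n + 2 + 2 = n + 4 by ring.
have -> : n + N + 2 - 2 = n + N by ring.
have -> : n + 2 + 1 = n + 3 by ring.
have -> : n + N + 2 - 1 = n + N + 1 by ring.
have -> : n + 1 + 3 = n + 4 by ring.
have -> : n + 1 + 1 = n + 2 by ring.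
have -> : n + N - 1 + 3 = n + N + 2 by ring.
have -> : n + N - 1 + 1 = n + N by ring.
have -> : n + N - 1 + 2 = n + N + 1 by ring.
have -> : n + 1 + N - 2 = n + N - 1 by ring.
have -> : n + 1 + N = n + N + 1 by ring.
move/eqP; rewrite eqr_div ?mulf_neq0 ?t_neq0 // => /eqP E.
apply/eqP; rewrite -subr_eq0.
set a := (X in X - _ == 0); set b := (X in _ - X == 0).
set L := LHS in E; set P := RHS in E.
(* The difference of the two sides of the goal is that of the cross-multiplied periodicity relation
   [E], over the common denominator of [y (n + N - 1)] and [y n]. *)
have -> : a - b = (L - P) /
    (t (n + 1) * t (n + 2) * t (n + N) * t (n + N + 1)).
  by rewrite /a /b /L /P; field; rewrite !t_neq0.
by rewrite E subrr mul0r.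
Qed.

End SomosReduction.

Theorem theorem6p6 (R : realType) (N : nat) (hN : (4 <= N)%N)
  (beta : R[i]) (alpha : int -> R[i])
  (halpha : forall n : int, alpha (n + 2) = alpha n)
  (t : int -> R[i])
  (ht0 : forall n : int, t n != 0)
  (ht : forall n : int,
    t n * t (n + N%:Z) =
      alpha n * t (n + 1) * t (n + N%:Z - 1)
      + beta * t (n + 2) * t (n + N%:Z - 2))
  (y : int -> R[i])
  (hy : forall n : int, y n = (t n * t (n + 3)) / (t (n + 1) * t (n + 2))) :
  exists H : R[i], forall n : int,
    y (n + 1) * (\sum_(0 <= j < N - 2) y (n + j%:Z) - H) =
    y (n + N%:Z - 2) * (\sum_(0 <= j < N - 2) y (n + j%:Z + 2) - H).
Proof.
pose w := twist _ t N%:Z.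
have mulw n : y (n + 1) * w n = y (n + N%:Z - 2) * w (n + 1).
  exact: mul_twist.
have subw n : y (n + N%:Z - 1) - y n = beta * (w (n + 1) - w n).
  exact: (sub_twist _ _ _ _ ht0 hy _ _ halpha ht).
(* The truncated subtraction on [nat] is a true one because [2 <= N]. *)
have N2E : (N - 2)%:Z = N%:Z - 2 by rewrite subzn // (leq_trans _ hN).
set M := (N - 2)%N in N2E *.
(* One term longer than the sums of the theorem: these are [S n] without its last term and
   [S (n + 1)] without its first. *)
pose S n := \sum_(0 <= j < M.+1) y (n + j%:Z).
have Slast n : S n = \sum_(0 <= j < M) y (n + j%:Z) + y (n + N%:Z - 2).
  by rewrite /S big_nat_recr //= N2E addrA.
have Sfirst n : S (n + 1) = y (n + 1) + \sum_(0 <= j < M) y (n + j%:Z + 2).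
  rewrite /S big_nat_recl //= addr0; congr (_ + _).
  by apply: eq_bigr => j _; congr y; rewrite intS; ring.
have Sshift n : S (n + 1) - S n = y (n + N%:Z - 1) - y n.
  rewrite /S big_nat_recr // [X in _ - X]big_nat_recl //= addr0.
  under [X in _ - (_ + X)]eq_bigr => j _ do rewrite intS addrA.
  have -> : n + 1 + M%:Z = n + N%:Z - 1 by rewrite N2E; ring.
  ring.
have Hconst n : S n - beta * w n = S 0 - beta * w 0.
  apply: (int_shift_invariant _ (fun n => S n - beta * w n)) => {}n.
  by rewrite -[S (n + 1)](subrK (S n)) Sshift subw; ring.
exists (S 0 - beta * w 0) => n.
set H := S 0 - _ in Hconst *.
have SE m : S m - H = beta * w m by rewrite -(Hconst m); ring.
have -> : \sum_(0 <= j < M) y (n + j%:Z) - H = beta * w n - y (n + N%:Z - 2).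
  by rewrite -SE Slast; ring.
have -> : \sum_(0 <= j < M) y (n + j%:Z + 2) - H = beta * w (n + 1) - y (n + 1).
  by rewrite -SE Sfirst; ring.
(* Both sides subtract the same product [y (n + 1) * y (n + N - 2)]; what remains is [beta] times
   [mulw]. *)
by rewrite !mulrBr !(mulrCA _ beta) mulw [y (n + 1) * y _]mulrC.
Qed.
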